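(* Let $G$ be a non-trivial finite group and let $P$ be a finite free $G$-poset. Then $$\mathrm{ind}_{G}\,\|\Delta(P)\|+1\leq \chi\left(\widetilde{C}_P\right).$$
   Context: A $G$-poset is a partially ordered set $(P,\preceq)$ with an action of $G$ preserving the order ($x\preceq y\Rightarrow g\cdot x\preceq g\cdot y$); it is free if $g\cdot x=x$ implies $g=e$ (the identity). For $x\in P$, $[x]=\{g\cdot x:g\in G\}$. The strong compatibility graph $\widetilde{C}_P$ has vertex set $P$, with $x,y$ adjacent if there is $g\in G\setminus\{e\}$ such that $x$ and $g\cdot y$ are comparable in $P$ and $y\notin[x]$. $\Delta(P)$ is the order complex of $P$ (simplices are the chains of $P$), with the induced $G$-action, and $\|\cdot\|$ denotes geometric realization. For $n\ge 0$, an $\mathbb{E}_nG$ space is the geometric realization of an $(n-1)$-connected free $n$-dimensional simplicial $G$-complex; for a $G$-space $X$, $\mathrm{ind}_G X=\min\{n: \text{there is a continuous } G\text{-equivariant map } X\to \mathbb{E}_nG\}$ (this does not depend on the choice of $\mathbb{E}_nG$). $\chi$ denotes the chromatic number. *)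

(* Defs.v *)
From mathcomp Require Import all_boot all_order all_algebra all_fingroup.
From mathcomp Require Import all_classical all_reals all_analysis.
From mathcomp Require Import Rstruct Rstruct_topology.
From Stdlib Require Import Rdefinitions.
Import numFieldNormedType.Exports.

Set Implicit Arguments.
Unset Strict Implicit.
Unset Printing Implicit Defensive.

Import Order.TTheory GRing.Theory Num.Theory.
Local Open Scope classical_set_scope.
Local Open Scope ring_scope.

Notation RR := Rdefinitions.R.

Definition is_gaction (gT : finGroupType) (X : Type) (act : gT -> X -> X) :=
  (forall x, act 1%g x = x) /\ (forall g h x, act (g * h)%g x = act g (act h x)).

Definition is_poset (T : finType) (le : rel T) :=
  [/\ reflexive le, antisymmetric le & transitive le].

Definition is_Gposet (gT : finGroupType) (T : finType) (le : rel T)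
    (act : gT -> T -> T) :=
  [/\ is_poset le, is_gaction act &
      forall g x y, le x y -> le (act g x) (act g y)].

Definition free_on (gT : finGroupType) (X : Type) (act : gT -> X -> X)
    (A : set X) :=
  forall g x, A x -> act g x = x -> g = 1%g.

Definition comparableb (T : finType) (le : rel T) (x y : T) : bool :=
  le x y || le y x.

Definition in_orbit (gT : finGroupType) (T : finType) (act : gT -> T -> T)
    (x y : T) : bool :=
  [exists g : gT, y == act g x].

Definition strong_compat (gT : finGroupType) (T : finType) (le : rel T)
    (act : gT -> T -> T) : rel T :=
  fun x y => [exists g : gT, (g != 1%g) && comparableb le x (act g y)]
             && ~~ in_orbit act x y.

Definition colorable (T : finType) (e : rel T) (k : nat) : bool :=
  [exists c : {ffun T -> 'I_k}, [forall x, forall y, e x y ==> (c x != c y)]].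

(* least k admitting a proper k-colouring; a loopless graph is always
   #|T|-colourable (junk value 0 only for graphs with loops) *)
Definition chromatic_number (T : finType) (e : rel T) : nat :=
  match @idP (colorable e #|T|) with
  | ReflectT H => ex_minn (ex_intro (fun k => colorable e k) #|T| H)
  | ReflectF _ => 0
  end.

Definition simplicial_complex (V : finType) (S : {set {set V}}) :=
  finset.set0 \notin S /\
  (forall s t : {set V}, s \in S -> t \subset s -> t != finset.set0 -> t \in S).

Definition simplicial_dim (V : finType) (S : {set {set V}}) (n : nat) :=
  (forall s : {set V}, s \in S -> leq #|s| n.+1) /\
  exists2 s : {set V}, s \in S & #|s| = n.+1.

(* ||S|| inside R^V (product topology): convex combinations of vertices
   whose support is a simplex *)
Definition realization (V : finType) (S : {set {set V}}) : set {ptws V -> RR} :=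
  [set f | (forall v, 0 <= f v)%R /\ (\sum_(v : V) f v = 1)%R /\
           finset (fun v => f v != 0%R) \in S].

Definition pt_act (gT : finGroupType) (V : finType) (act : gT -> V -> V)
    (g : gT) (f : {ptws V -> RR}) : {ptws V -> RR} :=
  fun v => f (act g^-1%g v).

Definition is_simplicial_Gcomplex (gT : finGroupType) (V : finType)
    (S : {set {set V}}) (act : gT -> V -> V) :=
  [/\ simplicial_complex S, is_gaction act &
      forall g (s : {set V}), s \in S -> (act g @: s) \in S].

Definition order_complex (T : finType) (le : rel T) : {set {set T}} :=
  [set s : {set T} | (s != finset.set0) &&
     [forall x in s, forall y in s, comparableb le x y]].

(* S^k and D^(k+1), both inside R^(k+1) *)
Definition unit_sphere (k : nat) : set {ptws 'I_k.+1 -> RR} :=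
  [set v | (\sum_(i < k.+1) v i ^+ 2 = 1)%R].
Definition unit_disk (k : nat) : set {ptws 'I_k.+1 -> RR} :=
  [set v | (\sum_(i < k.+1) v i ^+ 2 <= 1)%R].

Arguments unit_sphere k _ : clear implicits.
Arguments unit_disk k _ : clear implicits.

(* X is (n-1)-connected: nonempty ((-1)-connected) and every continuous map
   S^k -> X, 0 <= k <= n-1, extends continuously to D^(k+1) -> X *)
Definition connected_below (Y : topologicalType) (X : set Y) (n : nat) :=
  X !=set0 /\
  forall k : nat, ltn k n -> forall phi : {ptws 'I_k.+1 -> RR} -> Y,
    {within unit_sphere k, continuous phi} -> phi @` unit_sphere k `<=` X ->
    exists psi : {ptws 'I_k.+1 -> RR} -> Y,
      [/\ {within unit_disk k, continuous psi}, psi @` unit_disk k `<=` X &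
          forall v, unit_sphere k v -> psi v = phi v].

Definition is_EnG (gT : finGroupType) (n : nat) (V : finType)
    (S : {set {set V}}) (act : gT -> V -> V) :=
  [/\ is_simplicial_Gcomplex S act, simplicial_dim S n,
      free_on (pt_act act) (realization S) &
      connected_below (realization S) n].

Definition Gmap (gT : finGroupType) (X Y : topologicalType)
    (actX : gT -> X -> X) (actY : gT -> Y -> Y) (A : set X) (B : set Y)
    (F : X -> Y) :=
  [/\ {within A, continuous F}, F @` A `<=` B &
      forall g x, A x -> F (actX g x) = actY g (F x)].

Definition maps_to_EnG (gT : finGroupType) (X : topologicalType)
    (actX : gT -> X -> X) (A : set X) (n : nat) :=
  exists (V : finType) (S : {set {set V}}) (act : gT -> V -> V),
    is_EnG n S act /\
    exists F : X -> {ptws V -> RR}, Gmap actX (pt_act act) A (realization S) F.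

(* Main.v *)
(** Colour each orbit of P by the colour c(r) of a chosen representative r, and
    send g.r to the vertex (g, c(r)) of the join of chi copies of G.  Comparable
    g.r and h.s in distinct orbits with c(r) = c(s) have g = h, as otherwise r
    and s are adjacent; so this is an equivariant simplicial map into a free
    complex of dimension chi - 1.

    Connectivity of the join of C copies of a finite set A: a map into it is a
    family of functions f_(a,i) >= 0 with sum 1 such that, for each colour i, at
    most one f_(a,i) is nonzero at each point.  Given such a family on S^k with
    k + 1 < C, the radial extension F(x) = |x| f(x/|x|) only fails to be a point
    of the (unnormalised) join at x = 0.  Near 0 shrink F to 0 wherever it is at
    most eta, and add bumps supported on the open cells of C shifted fine grids,
    the i-th grid being used in colour i.  Each coordinate of x blocks at most
    one grid, and there are k + 1 < C coordinates, so some bump is positive at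
    x.  On each cell at most one shrunk F_(a,i) is ever nonzero, and the bump is
    added to that branch a, so the colour condition survives. *)

Require Import Defs.
From mathcomp Require Import all_boot all_order all_algebra all_fingroup.
From mathcomp Require Import all_classical all_reals all_analysis.
From mathcomp Require Import Rstruct Rstruct_topology.
From mathcomp Require Import zify ring lra.
Import numFieldNormedType.Exports.

Set Implicit Arguments.
Unset Strict Implicit.
Unset Printing Implicit Defensive.

Import Order.TTheory GRing.Theory Num.Theory.
Local Open Scope classical_set_scope.
Local Open Scope ring_scope.

(** * Pointwise convergence of real-valued families *)

Section generic_reals.
Variable R : realType.

Lemma ptws_eval_continuous (I : eqType) (i : I) :
  continuous (fun f : {ptws I -> R} => f i : R).
Proof. exact: (@proj_continuous _ (fun _ => R) i). Qed.

Lemma cvg_ptws (I : eqType) (X : Type) (F : set_system X) {FF : Filter F}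
    (f : X -> {ptws I -> R}) (l : {ptws I -> R}) :
  (forall i, (fun x => f x i : R) @ F --> (l i : R)) -> f @ F --> l.
Proof.
move=> fl; apply/cvg_sup => i; apply/cvg_image.
  by apply/seteqP; split => // y _; exists (fun=> y).
move=> A /= Al.
exists (@^~ i @^-1` A); first exact: (fl i A Al).
by apply/seteqP; split=> [y [g Ag <-]//|y Ay]; exists (fun=> y).
Qed.

(** * Euclidean norm, radial extension and uniform continuity *)

Section euclidean.
Variable k : nat.
Local Notation E := {ptws 'I_k.+1 -> R}.

Definition sphere : set E := [set x | \sum_(i < k.+1) x i ^+ 2 = 1].
Definition disk : set E := [set x | \sum_(i < k.+1) x i ^+ 2 <= 1].

Definition enorm (x : E) : R := Num.sqrt (\sum_(i < k.+1) x i ^+ 2).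

Lemma enorm_continuous : continuous enorm.
Proof.
have cS : continuous (fun x : E => \sum_(i < k.+1) x i ^+ 2).
  apply: continuous_big => [|i _ x]; first exact: add_continuous.
  apply: (@continuous_comp _ _ _ (fun x : E => x i) (fun t : R => t ^+ 2)).
    exact: ptws_eval_continuous.
  exact: exprn_continuous.
move=> x; apply: (@continuous_comp _ _ _ (fun x : E => \sum_(i < k.+1) x i ^+ 2));
  last exact: sqrt_continuous.
exact: cS.
Qed.

Lemma enorm_ge0 x : 0 <= enorm x. Proof. exact: sqrtr_ge0. Qed.

Lemma enorm_sqr x : enorm x ^+ 2 = \sum_(i < k.+1) x i ^+ 2.
Proof. by rewrite sqr_sqrtr// sumr_ge0// => i _; exact: sqr_ge0. Qed.

Lemma sphereE x : sphere x <-> enorm x = 1.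
Proof.
rewrite /sphere/=; split=> [xS|x1].
  by rewrite /enorm xS sqrtr1.
by rewrite -enorm_sqr x1 expr1n.
Qed.

Lemma diskE x : disk x <-> enorm x <= 1.
Proof.
rewrite /disk/= -enorm_sqr.
by rewrite expr_le1// enorm_ge0.
Qed.

Lemma coord_le_enorm x i : `|x i| <= enorm x.
Proof.
rewrite -ler_sqr ?nnegrE ?enorm_ge0// enorm_sqr real_normK ?num_real//.
by rewrite (bigD1 i)//= lerDl sumr_ge0// => j _; exact: sqr_ge0.
Qed.

(** At the origin division by zero gives the value 0; [radial] multiplies by the norm, so this value
    is harmless. *)
Definition edir (x : E) : E := fun j => x j / enorm x.

Lemma edir_sphere x : enorm x != 0 -> sphere (edir x).
Proof.
move=> x0; rewrite /sphere/= /edir.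
under eq_bigr do rewrite expr_div_n.
by rewrite -mulr_suml -enorm_sqr divff// expf_neq0.
Qed.

Lemma edir_id x : sphere x -> edir x = x.
Proof.
by move=> /sphereE x1; apply/funext => j; rewrite /edir x1 divr1.
Qed.

(** The limit filter is restricted to the sphere because the maps composed with [edir] are
    continuous only there. *)
Lemma edir_cvg x : enorm x != 0 ->
  edir @ x --> within (sphere) (nbhs (edir x)).
Proof.
move=> x0.
have cx : edir @ x --> edir x.
  apply: (@cvg_ptws _ _ (nbhs x) _ edir (edir x)) => i.
  apply: (@cvgM R E (nbhs x) _ (fun x : E => x i) (fun x => (enorm x)^-1)).
    exact: ptws_eval_continuous.
  by apply: (cvgV (f := enorm)) => //; exact: enorm_continuous.
have nx : \forall y \near x, enorm y != 0.
  exact: (@cvgr_neq0 R R^o E (nbhs x) _ enorm (enorm x)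
    (@enorm_continuous x) x0).
move=> A /= /cx cA.
apply: (@filterS2 E (nbhs x) _ _ _ _ _ cA nx) => y Ay /edir_sphere; exact: Ay.
Qed.

(* The boxes generate a filter converging to x coordinatewise. *)
Lemma nbhs_box (x : E) (A : set E) : nbhs x A ->
  exists2 d : R, 0 < d & forall z : E, (forall i, `|x i - z i| < d) -> A z.
Proof.
pose B (d : R) : set E := [set z | forall i, `|x i - z i| < d].
pose F := filter_from [set d : R | 0 < d] B.
have FF : Filter F.
  apply: filter_from_filter; first by exists 1; exact: ltr01.
  move=> d e /= d0 e0; exists (Num.min d e); first by rewrite /= lt_min d0 e0.
  by move=> z Bz; split=> i; have := Bz i; rewrite lt_min => /andP[].
have Fx : F --> x.
  apply: (@cvg_ptws _ E F _ id x) => i.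
  apply/(@cvgrPdist_lt R R^o) => e e0; exists e => // z; exact.
by move=> /Fx[d d0 dA]; exists d.
Qed.

Definition radial (f : E -> R) (x : E) : R := enorm x * f (edir x).

(** At the origin the bounds on [f] squeeze the value between 0 and [enorm]; elsewhere [edir] is
    continuous. *)
Lemma radial_continuous (f : E -> R) :
  (forall x, sphere x -> 0 <= f x <= 1) ->
  {within sphere, continuous f} -> continuous (radial f).
Proof.
move=> f01 /subspace_continuousP cf x.
have [x0|x0] := eqVneq (enorm x) 0; last first.
  apply: (@cvgM R E (nbhs x) _ enorm (f \o edir)).
    exact: enorm_continuous.
  exact: (@cvg_comp E E R edir f (nbhs x) (within sphere (nbhs (edir x)))
    (nbhs (f (edir x))) (@edir_cvg x x0) (cf _ (edir_sphere x0))).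
rewrite /continuous_at {2}/radial x0 mul0r.
apply: (@squeeze_cvgr E (nbhs x) _ R (cst 0) enorm).
- apply: nearW => y; rewrite /radial /=; have [->|y0] := eqVneq (enorm y) 0.
    by rewrite mul0r lexx.
  have /andP[f0 f1] := f01 _ (edir_sphere y0).
  by rewrite mulr_ge0 ?enorm_ge0//= ler_piMr// enorm_ge0.
- exact: cvg_cst.
- by rewrite -[0]x0; exact: enorm_continuous.
Qed.

Lemma box_compact (M : R) : compact [set x : E | forall i, `|x i| <= M].
Proof.
have -> : [set x : E | forall i, `|x i| <= M] =
          [set x : E | forall i, [set` `[- M, M]] (x i)].
  by apply/seteqP; split => x /= xM i; have := xM i; rewrite /= in_itv/= ler_norml.
exact: (@tychonoff 'I_k.+1 (fun _ => R) (fun _ => [set` `[- M, M]])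
  (fun _ => @segment_compact R _ _)).
Qed.

(** Heine-Cantor: one mesh works on a whole neighbourhood of each point, and compactness of the box
    makes it global. *)
Lemma unif_continuous_box (V : finType) (F : V -> E -> R) (eta M : R) :
  (forall v, continuous (F v)) -> 0 < eta ->
  exists N : nat, forall x y : E, (forall i, `|x i| <= M) ->
    (forall i, `|x i - y i| < N.+1%:R^-1) -> forall v, `|F v x - F v y| < eta.
Proof.
move=> cF eta0.
have /compact_near_coveringP ncB := @box_compact M.
pose P (n : nat) (x : E) := forall y : E, (forall i, `|x i - y i| < n.+1%:R^-1) ->
  forall v, `|F v x - F v y| < eta.
suff /ncB [] : forall x : E, (forall i, `|x i| <= M) ->
    \forall x' \near x & n \near \oo, P n x'.
  move=> N _ NP; exists N => x y xM xy v.
  exact: (NP N (leqnn N) x xM y xy v).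
move=> x _.
have eta20 : 0 < eta / 2 by rewrite divr_gt0.
have /nbhs_box[d d0 dF] : \forall z \near x, forall v, `|F v x - F v z| < eta / 2.
  apply: (@filter_forall E _ _ (nbhs x) _) => v.
  exact: (@cvgr_dist_lt R R^o E (nbhs x) _ (F v) (F v x) (cF v x) _ eta20).
have d20 : 0 < d / 2 by rewrite divr_gt0.
exists ([set z : E | forall i, `|x i - z i| < d / 2],
        [set n : nat | n.+1%:R^-1 < d / 2]).
  split => /=; last exact: (near_infty_natSinv_lt (PosNum d20)).
  apply: (@filter_forall E _ _ (nbhs x) _) => i.
  exact: (@cvgr_dist_lt R R^o E (nbhs x) _ (fun z => z i) (x i)
    (@ptws_eval_continuous _ i x) _ d20).
move=> [x' n] /= [xx' nd] y x'y v.
rewrite (le_lt_trans (ler_distD (F v x) _ _))// (splitr eta) ltrD//.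
  rewrite distrC dF// => i; rewrite (lt_le_trans (xx' i))//.
  by rewrite ler_pdivrMr// ler_peMr ?ler1n// ltW.
rewrite dF// => i; rewrite (le_lt_trans (ler_distD (x' i) _ _))//.
by rewrite (splitr d) ltrD// (lt_trans (x'y i)).
Qed.

(** * Shifted grids and their bumps *)

Section grid.
Variables (C N : nat).
Implicit Types (i : 'I_C) (j : 'I_k.+1) (x y : E).

(** Grid [i] has side 1/(N+1) and is shifted diagonally by i/C of a side; its hyperplanes are where
    a [gcoord] is an integer. *)
Definition gcoord i j x : R := N.+1%:R * x j - i%:R / C%:R.

Definition gcell i x : {ffun 'I_k.+1 -> int} :=
  [ffun j => Num.floor (gcoord i j x)].

(** For [q = gcell i x] each factor is t(1-t) with t a fractional part. Keeping [q] separate makes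
    the bump a polynomial in [x]. *)
Definition gbump (q : {ffun 'I_k.+1 -> int}) i x : R :=
  \prod_j ((gcoord i j x - (q j)%:~R) * (1 - (gcoord i j x - (q j)%:~R))).

Lemma gcoord_continuous i j : continuous (gcoord i j).
Proof.
move=> x; apply: (@cvgB R R^o E (nbhs x) _ (fun x => N.+1%:R * x j)
  (fun=> i%:R / C%:R)); last exact: cvg_cst.
apply: (@cvgM R E (nbhs x) _ (fun=> N.+1%:R) (fun x => x j)).
  exact: cvg_cst.
exact: ptws_eval_continuous.
Qed.

Lemma gbump_continuous q i : continuous (gbump q i).
Proof.
apply: continuous_big => [|j _ x]; first exact: mul_continuous.
have ct : (fun x => gcoord i j x - (q j)%:~R) @ x --> gcoord i j x - (q j)%:~R.
  apply: (@cvgB R R^o E (nbhs x) _ (gcoord i j) (fun=> (q j)%:~R)).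
    exact: gcoord_continuous.
  exact: cvg_cst.
apply: (@cvgM R E (nbhs x) _ (fun x => gcoord i j x - (q j)%:~R)
  (fun x => 1 - (gcoord i j x - (q j)%:~R))) => //.
by apply: (@cvgB R R^o E (nbhs x) _ (fun=> 1)) => //; exact: cvg_cst.
Qed.

Lemma gcell_factor i j x (m := Num.floor (gcoord i j x)) :
  0 <= (gcoord i j x - m%:~R) * (1 - (gcoord i j x - m%:~R)) <= 1.
Proof.
have := floor_itv (gcoord i j x); rewrite -/m intrD.
move: (gcoord i j x) (m%:~R : R) => t f /andP[ft tf].
by apply/andP; split; nra.
Qed.

(** t(1-t) is at most both t and 1-t, hence at most the distance to the nearest integer. *)
Lemma gcell_factor_le i j x (n : int) (m := Num.floor (gcoord i j x)) :
  (gcoord i j x - m%:~R) * (1 - (gcoord i j x - m%:~R)) <=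
  `|gcoord i j x - n%:~R|.
Proof.
have := floor_itv (gcoord i j x); rewrite -/m intrD.
move: (gcoord i j x) => t /andP[mt tm].
have [nm|mn] := leP n m.
  have : (n%:~R : R) <= m%:~R by rewrite ler_int.
  move: (n%:~R : R) (m%:~R : R) mt tm => a b mt tm ab.
  by rewrite ger0_norm; nra.
have : (m%:~R : R) + 1 <= n%:~R.
  by rewrite -[1]/(1%:~R) -intrD ler_int addrC lez1D.
move: (n%:~R : R) (m%:~R : R) mt tm => a b mt tm ab.
by rewrite ler0_norm; nra.
Qed.

Lemma gbump_ge0 i x : 0 <= gbump (gcell i x) i x.
Proof.
apply: prodr_ge0 => j _; rewrite ffunE.
by have /andP[] := gcell_factor i j x.
Qed.

Lemma gbump_le i x j (n : int) :
  gbump (gcell i x) i x <= `|gcoord i j x - n%:~R|.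
Proof.
rewrite /gbump (bigD1 j)//= ffunE.
apply: le_trans (gcell_factor_le i j x n).
have /andP[f0 _] := gcell_factor i j x.
rewrite ler_piMr// prodr_ile1// => l _; rewrite ffunE.
exact: gcell_factor.
Qed.

(** The weight can jump only across a hyperplane, and there [gbump_le] squeezes the product to 0.
    Off the hyperplanes the cell is locally constant. *)
Lemma gbump_weight_continuous i (q : {ffun 'I_k.+1 -> int} -> R) :
  (forall c, 0 <= q c <= 1) ->
  continuous (fun x => gbump (gcell i x) i x * q (gcell i x)).
Proof.
move=> q01 x.
have [/existsP[j /eqP tj]|/existsPn tN] := boolP
    [exists j, gcoord i j x == (Num.floor (gcoord i j x))%:~R].
  have bx0 : gbump (gcell i x) i x = 0.
    apply/eqP; rewrite eq_le gbump_ge0 andbT.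
    by rewrite (le_trans (gbump_le i x j (Num.floor (gcoord i j x))))// -tj subrr normr0.
  rewrite /continuous_at bx0 mul0r.
  apply: (@squeeze_cvgr E (nbhs x) _ R (cst 0)
    (fun y => `|gcoord i j y - (Num.floor (gcoord i j x))%:~R|)).
  - apply: nearW => y /=; have /andP[q0 q1] := q01 (gcell i y).
    rewrite mulr_ge0 ?gbump_ge0//=.
    apply: le_trans (gbump_le i y j _).
    by rewrite ler_piMr// gbump_ge0.
  - exact: cvg_cst.
  - rewrite -[X in _ --> X](_ : `|gcoord i j x - (Num.floor (gcoord i j x))%:~R| = 0); last first.
      by rewrite -tj subrr normr0.
    apply: (@cvg_norm R R^o).
    apply: (@cvgB R R^o E (nbhs x) _ (gcoord i j)); last exact: cvg_cst.
    exact: gcoord_continuous.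
have cellx : \forall y \near x, gcell i y = gcell i x.
  have : \forall y \near x, forall j, gcell i y j = gcell i x j.
    apply: (@filter_forall E _ _ (nbhs x) _) => j.
    have /andP[fl fr] := floor_itv (gcoord i j x).
    have fl' : (Num.floor (gcoord i j x))%:~R < gcoord i j x.
      by rewrite lt_neqAle fl andbT eq_sym.
    apply: (@filterS2 E (nbhs x) _ _ _ _ _
      (@cvgr_gt R E (nbhs x) _ _ _ (@gcoord_continuous i j x) _ fl')
      (@cvgr_lt R E (nbhs x) _ _ _ (@gcoord_continuous i j x) _ fr)) => y yl yr.
    by rewrite !ffunE; apply: floor_def; rewrite yr ltW.
  by apply: filterS => y yx; apply/ffunP.
pose G y := gbump (gcell i x) i y * q (gcell i x).
have FG : {near nbhs x, G =1 fun y => gbump (gcell i y) i y * q (gcell i y)}.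
  by apply: (@filterS E (nbhs x) _ _ _ _ cellx) => y /= ->.
have Gx : G @ x --> G x.
  apply: (@cvgM R E (nbhs x) _ (gbump (gcell i x) i)); last exact: cvg_cst.
  exact: gbump_continuous.
move=> A /Gx GA; apply: (@filterS2 E (nbhs x) _ _ _ _ _ FG GA) => y /= <- //.
Qed.

Lemma gcell_close i x y : gcell i x = gcell i y ->
  forall j, `|x j - y j| < N.+1%:R^-1.
Proof.
move=> xy j; move/ffunP/(_ j) : xy; rewrite !ffunE => xy.
have /andP[xl xr] := floor_itv (gcoord i j x).
have /andP[yl yr] := floor_itv (gcoord i j y).
rewrite -xy in yl yr.
rewrite -[_^-1]mul1r ltr_pdivlMr// -[N.+1%:R](@ger0_norm R)// -normrM.
have -> : (x j - y j) * N.+1%:R = gcoord i j x - gcoord i j y.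
  by rewrite /gcoord; ring.
rewrite intrD in xr yr; rewrite ltr_norml; apply/andP; split; lra.
Qed.

(* Pigeonhole: each coordinate of x lies on a grid hyperplane of at most one of the C
   diagonally shifted grids. *)
Lemma gbump_gt0 x : (k.+1 < C)%N -> exists i, 0 < gbump (gcell i x) i x.
Proof.
move=> kC; apply: contrapT => xN.
have {xN} xj i : exists j, gcoord i j x \is a Num.int.
  apply: contrapT => ij; apply: xN; exists i.
  apply: prodr_gt0 => j _; rewrite ffunE.
  have /andP[l r] := floor_itv (gcoord i j x).
  have fl' : (Num.floor (gcoord i j x))%:~R < gcoord i j x.
    rewrite lt_neqAle l andbT -intrEfloor; apply/negP => jint.
    by apply: ij; exists j.
  by rewrite mulr_gt0// ?subr_gt0//; rewrite intrD in r; lra.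
have [f fint] := choice xj.
have /injectivePn[i [i' ii' ff]] : ~~ injectiveb f.
  apply: contraL kC => /injectiveP /leq_card.
  by rewrite !card_ord -leqNgt.
have : gcoord i' (f i) x - gcoord i (f i) x \is a Num.int.
  by rewrite rpredB// ff.
have -> : gcoord i' (f i) x - gcoord i (f i) x = (i%:R - i'%:R) / C%:R.
  by rewrite /gcoord; ring.
have C0 : (0 : R) < C%:R by rewrite ltr0n (leq_trans _ kC).
(* [i - i'] is [m * C] and has absolute value below [C], so [m = 0] and the indices coincide. *)
move=> /intrP[m mE].
have {mE} mC : (i%:Z - i'%:Z) = m * C%:Z.
  apply/eqP; rewrite -(eqr_int R) rmorphB rmorphM /= -!pmulrn.
  by rewrite -mE divfK//; rewrite gt_eqF.
case/eqP: ii'; apply/val_inj => /=.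
have := ltn_ord i; have := ltn_ord i'; move: mC; clear.
move: (i : nat) (i' : nat) => a b.
have [->|m0] := eqVneq m 0; first by rewrite mul0r => /eqP; rewrite subr_eq0 => /eqP[].
nia.
Qed.

End grid.

(** * Extension from the sphere to the disk inside a join *)

Definition join_point (A : finType) (C : nat) (f : A * 'I_C -> R) : Prop :=
  [/\ forall v, 0 <= f v, \sum_v f v = 1 &
      forall u v, f u != 0 -> f v != 0 -> u.2 = v.2 -> u = v].

Section extension.
Variables (A : finType) (a0 : A) (C : nat) (phi : E -> A * 'I_C -> R).
Hypothesis kC : (k.+1 < C)%N.
Hypothesis phiP : forall x, sphere x -> join_point (phi x).
Hypothesis phi_continuous :
  forall v, {within sphere, continuous (fun x => phi x v)}.
Local Notation V := (A * 'I_C)%type.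

Let F (v : V) : E -> R := radial (fun x => phi x v).
(** If every [F v x] is at most [eta], their sum [enorm x] is at most 1/2, below the threshold 3/4
    of [fade]. *)
Let eta : R := (2 * #|{: V}|%:R)^-1.

Let V_gt0 : 0 < #|{: V}|%:R :> R.
Proof.
rewrite ltr0n; apply/card_gt0P; have C0 := leq_trans (ltn0Sn _) kC.
by exists (a0, Ordinal C0).
Qed.

Let eta_gt0 : 0 < eta.
Proof. by rewrite invr_gt0 mulr_gt0. Qed.

Let F_continuous v : continuous (F v).
Proof.
apply: radial_continuous => // x /phiP[f0 f1 _]; rewrite f0 -f1/=.
by rewrite (bigD1 v)//= lerDl sumr_ge0.
Qed.

Let F_ge0 v x : 0 <= F v x.
Proof.
have [x0|x0] := eqVneq (enorm x) 0; first by rewrite /F /radial x0 mul0r.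
have [f0 _ _] := phiP (edir_sphere x0).
by rewrite mulr_ge0 ?enorm_ge0.
Qed.

Let F_sum x : \sum_v F v x = enorm x.
Proof.
rewrite -mulr_sumr; have [->|x0] := eqVneq (enorm x) 0; first by rewrite mul0r.
by have [_ -> _] := phiP (edir_sphere x0); rewrite mulr1.
Qed.

Let F_branch x u v : F u x != 0 -> F v x != 0 -> u.2 = v.2 -> u = v.
Proof.
rewrite /F /radial !mulf_eq0 !negb_or => /andP[x0 u0] /andP[_ v0].
by have [_ _] := phiP (edir_sphere x0); exact.
Qed.

Let mesh : exists N : nat, forall x y : E, (forall i, `|x i| <= 1) ->
  (forall i, `|x i - y i| < N.+1%:R^-1) -> forall v, `|F v x - F v y| < eta.
Proof. exact: unif_continuous_box. Qed.
Let N := projT1 (cid mesh).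

(** This depends on the cell alone, as [gbump_weight_continuous] requires; [a0] is the value when no
    [F (a, i)] exceeds [eta] on the part of the cell in the disk. *)
Let branch (i : 'I_C) (c : {ffun 'I_k.+1 -> int}) : A :=
  xget a0 [set a | exists y, [/\ disk y, gcell N i y = c & eta < F (a, i) y]].

(** If [b] was chosen because [F (b, i) y > eta] elsewhere in the cell, the mesh gives
    [F (b, i) x > 0], and only one branch of colour [i] is nonzero at [x]. *)
Let branchE i a x : disk x -> eta < F (a, i) x -> branch i (gcell N i x) = a.
Proof.
move=> xD Fx; rewrite /branch; case: xgetP => [b _ [y [yD yx Fy]]|bN]; last first.
  by have := bN a; case; exists x.
have Fx0 : F (a, i) x != 0 by rewrite gt_eqF// (lt_trans eta_gt0).
apply/eqP; apply: contraT => ba; exfalso.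
have Fbx : F (b, i) x = 0.
  apply/eqP; apply: contraT => Fb0; have := F_branch Fb0 Fx0 erefl.
  by case => ba'; rewrite ba' eqxx in ba.
have xy : `|F (b, i) x - F (b, i) y| < eta.
  apply: (projT2 (cid mesh)).
    move=> j; apply: le_trans (coord_le_enorm x j) _; exact/diskE.
  by apply: (@gcell_close C _ i); rewrite yx.
move: xy; rewrite Fbx sub0r normrN ger0_norm ?F_ge0//.
by rewrite ltNge ltW.
Qed.

(* The bumps, scaled by [fade], only appear where [shrink] has reached its full
   value eta; there [branchE] applies to every surviving F v. *)
Let shrink (x : E) : R := eta * Num.min 1 (4 * (1 - enorm x)).
Let fade (x : E) : R := Num.max 0 (3 / 4 - enorm x).
Let bump (v : V) (x : E) : R :=
  gbump N (gcell N v.2 x) v.2 x * (branch v.2 (gcell N v.2 x) == v.1)%:R.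
Let Phi (v : V) (x : E) : R :=
  Num.max 0 (F v x - shrink x) + fade x * bump v x.

Let bump_ge0 v x : 0 <= bump v x.
Proof. by rewrite mulr_ge0 ?gbump_ge0// ler0n. Qed.

Let fade_ge0 x : 0 <= fade x.
Proof. by rewrite le_max lexx. Qed.

Let Phi_ge0 v x : 0 <= Phi v x.
Proof.
apply: addr_ge0; last exact: mulr_ge0 (fade_ge0 x) (bump_ge0 v x).
by rewrite le_max lexx.
Qed.

Let enorm_affine_continuous (a b : R) : continuous (fun x : E => a * (b - enorm x)).
Proof.
move=> x; apply: (@cvgM R E (nbhs x) _ (fun=> a) (fun x => b - enorm x)).
  exact: cvg_cst.
apply: (@cvgB R R^o E (nbhs x) _ (fun=> b)); first exact: cvg_cst.
exact: enorm_continuous.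
Qed.

Let Phi_continuous v : continuous (Phi v).
Proof.
move=> x.
apply: (@cvgD R R^o E (nbhs x) _ (fun x => Num.max 0 (F v x - shrink x))
  (fun x => fade x * bump v x)).
  apply: (@continuous_max R E (fun=> 0) (fun x => F v x - shrink x) x).
    exact: (@cst_continuous E R 0 x).
  apply: (@cvgB R R^o E (nbhs x) _ (F v) shrink).
    exact: F_continuous.
  apply: (@cvgM R E (nbhs x) _ (fun=> eta)
    (fun x => Num.min 1 (4 * (1 - enorm x)))); first exact: cvg_cst.
  apply: (@continuous_min R E (fun=> 1) (fun x => 4 * (1 - enorm x)) x).
    exact: (@cst_continuous E R 1 x).
  exact: enorm_affine_continuous.
apply: (@cvgM R E (nbhs x) _ fade (bump v)).
  apply: (@continuous_max R E (fun=> 0) (fun x => 3 / 4 - enorm x) x).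
    exact: (@cst_continuous E R 0 x).
  apply: (@cvgB R R^o E (nbhs x) _ (fun=> 3 / 4)); first exact: cvg_cst.
  exact: enorm_continuous.
apply: (@gbump_weight_continuous C N v.2 (fun c => (branch v.2 c == v.1)%:R)).
by move=> c; case: (_ == _); rewrite ?lexx ?ler01.
Qed.

Let shrink_ge0 x : disk x -> 0 <= shrink x.
Proof.
move=> /diskE x1; apply: mulr_ge0; first exact: ltW.
rewrite le_min ler01/=.
by rewrite mulr_ge0// subr_ge0.
Qed.

(** Inside radius 3/4 some bump and [fade] are positive; outside, if all [Phi] vanished, every
    [F v x] would be at most [eta] and the radius at most 1/2. *)
Let Phi_sum_gt0 x : disk x -> 0 < \sum_v Phi v x.
Proof.
move=> xD; have [x34|x34] := ltP (enorm x) (3 / 4).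
  have [i wi] := gbump_gt0 N x kC.
  rewrite (bigD1 (branch i (gcell N i x), i))//= ltr_pwDl ?sumr_ge0//.
  rewrite ltr_wpDl ?le_max ?lexx// mulr_gt0//.
    by rewrite lt_max subr_gt0 x34 orbT.
  by rewrite /bump/= eqxx mulr1.
rewrite lt_neqAle sumr_ge0// andbT eq_sym; apply/negP => /eqP S0.
have Phi0 v : Phi v x = 0.
  apply/eqP; rewrite eq_le Phi_ge0 andbT -S0 (bigD1 v)//= lerDl.
  by rewrite sumr_ge0.
have Fle v : F v x <= eta.
  have : Num.max 0 (F v x - shrink x) <= 0.
    rewrite -[leRHS](Phi0 v) lerDl.
    exact: mulr_ge0 (fade_ge0 x) (bump_ge0 v x).
  rewrite ge_max lexx/= subr_le0 => /le_trans; apply.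
  by rewrite ler_piMr ?(ltW eta_gt0)// ge_min lexx.
have : enorm x <= \sum_(v : V) eta by rewrite -F_sum ler_sum.
rewrite sumr_const -mulr_natr /eta invfM divfK ?gt_eqF//.
by move: x34; lra.
Qed.

(** A nonzero [Phi w] comes from [F w] above [shrink] or from a bump. Two of the first kind agree by
    [F_branch]; once a bump occurs, [fade] is positive and both agree with the [branch] of the
    cell. *)
Let Phi_branch x u v : disk x -> Phi u x != 0 -> Phi v x != 0 ->
  u.2 = v.2 -> u = v.
Proof.
move=> xD.
have PhiP w : Phi w x != 0 ->
    shrink x < F w x \/ 0 < fade x /\ branch w.2 (gcell N w.2 x) = w.1.
  move=> Pw; have [|Fw] := ltP (shrink x) (F w x); [by left|right].
  move: Pw; rewrite /Phi (max_idPl _) ?subr_le0// add0r mulf_eq0 negb_or.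
  rewrite /bump mulf_eq0 negb_or pnatr_eq0 eqb0 negbK.
  move=> /andP[f0 /andP[_ /eqP ->]]; split => //.
  by rewrite lt_neqAle eq_sym f0 le_max lexx.
have PhiF w : shrink x < F w x -> 0 < fade x ->
    branch w.2 (gcell N w.2 x) = w.1.
  rewrite /fade lt_max ltxx/= subr_gt0 => Fw x34.
  apply: branchE => //; rewrite -surjective_pairing; apply: le_lt_trans Fw.
  (* Radius below 3/4 makes 4(1 - |x|) exceed 1, so [shrink x] is exactly [eta]. *)
  by rewrite /shrink min_l ?mulr1//; move: x34; lra.
have F0 w : shrink x < F w x -> F w x != 0.
  by move=> Fw; rewrite gt_eqF// (le_lt_trans (shrink_ge0 xD)).
move=> /PhiP[Fu|[f0 gu]] /PhiP[Fv|[f0' gv]] uv.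
- by apply: F_branch uv; exact: F0.
- have gu := PhiF _ Fu f0'.
  by rewrite [u]surjective_pairing [v]surjective_pairing -gu -gv uv.
- have gv := PhiF _ Fv f0.
  by rewrite [u]surjective_pairing [v]surjective_pairing -gu -gv uv.
- by rewrite [u]surjective_pairing [v]surjective_pairing -gu -gv uv.
Qed.

(** At radius 1 both [shrink] and [fade] are 0. *)
Let Phi_sphere x v : sphere x -> Phi v x = phi x v.
Proof.
move=> xS; have /sphereE x1 := xS.
rewrite /Phi /shrink /fade x1 subrr mulr0 min_r ?ler01// mulr0 subr0.
rewrite (max_idPr (F_ge0 v x)) (max_idPl _); last by lra.
by rewrite mul0r addr0 /F /radial x1 mul1r edir_id.
Qed.

Lemma join_extension : exists psi : E -> V -> R,
  [/\ forall v x, disk x -> (fun y => psi y v) @ x --> psi x v,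
      forall x, disk x -> join_point (psi x) &
      forall x, sphere x -> psi x =1 phi x].
Proof.
(* Normalising by the positive sum lands in the join; on the sphere the sum is already 1. *)
exists (fun x v => Phi v x / \sum_u Phi u x); split.
- move=> v x xD.
  apply: (@cvgM R E (nbhs x) _ (Phi v) (fun x => (\sum_u Phi u x)^-1)).
    exact: Phi_continuous.
  apply: (@cvgV R E (nbhs x) _ (fun x => \sum_u Phi u x)).
    by rewrite gt_eqF// Phi_sum_gt0.
  move: x {xD}; apply: continuous_big => [|u _]; first exact: add_continuous.
  exact: Phi_continuous.
- move=> x xD; have S0 := Phi_sum_gt0 xD; split.
  + by move=> v; rewrite divr_ge0// ltW.
  + by rewrite -mulr_suml divff// gt_eqF.
  + move=> u v; rewrite !mulf_eq0 !negb_or => /andP[u0 _] /andP[v0 _].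
    exact: Phi_branch xD u0 v0.
- move=> x xS v; under eq_bigr do rewrite Phi_sphere//.
  by have [_ -> _] := phiP xS; rewrite divr1 Phi_sphere.
Qed.

End extension.

End euclidean.

(** * Affine extension of vertex maps in barycentric coordinates *)

Definition pushforward (T V : finType) (m : T -> V) (f : {ptws T -> R}) :
    {ptws V -> R} :=
  fun v => \sum_(x | m x == v) f x.

Lemma pushforward_continuous (T V : finType) (m : T -> V) :
  continuous (pushforward m).
Proof.
move=> f; apply: (@cvg_ptws V {ptws T -> R} (nbhs f)) => v.
move: f; apply: continuous_big => [|x _]; first exact: add_continuous.
exact: ptws_eval_continuous.
Qed.

End generic_reals.

(* In [realization], [unit_sphere] and [unit_disk] the key %R denotes Stdlib's
   R_scope, so their [<=], 0 and 1 are Rle, IZR 0 and IZR 1. *)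
Lemma realizationE (V : finType) (S : {set {set V}}) (f : {ptws V -> RR}) :
  realization S f <->
  [/\ forall v, 0 <= f v, \sum_v f v = 1 & finset (fun v => f v != 0) \in S].
Proof.
split=> [[f0 [f1 fS]]|[f0 f1 fS]]; split => //.
  by move=> v; apply/RleP; exact: f0.
by move=> v; apply/RleP; exact: f0.
Qed.

Lemma unit_sphereE (k : nat) : unit_sphere k = @sphere RR k.
Proof. by []. Qed.

Lemma unit_diskE (k : nat) : unit_disk k = @disk RR k.
Proof. by apply/seteqP; split => x /RleP. Qed.

(** * The join of C copies of a finite set and its connectivity *)

Section join_complex.
Variables (A : finType) (C : nat).
Local Notation V := (A * 'I_C)%type.

Definition join_complex : {set {set V}} :=
  [set s : {set V} | (s != finset.set0) &&
     [forall u in s, forall v in s, (u.2 == v.2) ==> (u == v)]].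

Lemma join_complexP (s : {set V}) : reflect
  (s != finset.set0 /\ {in s &, injective snd}) (s \in join_complex).
Proof.
rewrite inE; apply: (iffP andP) => -[s0 sP]; split => //.
  move=> u v us vs uv; move/forall_inP/(_ u us)/forall_inP/(_ v vs) : sP.
  by rewrite uv eqxx => /eqP.
apply/forall_inP => u us; apply/forall_inP => v vs; apply/implyP => /eqP uv.
by apply/eqP; exact: sP.
Qed.

Lemma realization_joinP (f : {ptws V -> RR}) :
  realization join_complex f <-> join_point f.
Proof.
rewrite realizationE.
split=> [[f0 f1 /join_complexP[_ fP]]|[f0 f1 fP]]; split => //.
  by move=> u v fu fv; apply: fP; rewrite inE.
apply/join_complexP; split.
  apply/set0Pn; apply: contrapT => s0.
  have : \sum_v f v = 0.
    rewrite big1// => v _; apply/eqP; apply: contraT => fv.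
    by exfalso; apply: s0; exists v; rewrite inE.
  by rewrite f1 => /eqP; rewrite oner_eq0.
by move=> u v; rewrite !inE; exact: fP.
Qed.

(** A sphere of dimension k < n has k + 1 < n + 1 = C, the bound that [join_extension] asks for. *)
Lemma join_connected (a0 : A) (n : nat) : C = n.+1 ->
  connected_below (realization join_complex) n.
Proof.
move=> Cn; split.
  have C0 : (0 < C)%N by rewrite Cn.
  pose v0 : V := (a0, Ordinal C0).
  exists (fun v => (v == v0)%:R); apply/realization_joinP; split.
  - by move=> v; rewrite ler0n.
  - by rewrite (bigD1 v0)//= eqxx big1 ?addr0// => v /negPf ->.
  - move=> u v; rewrite !pnatr_eq0 !eqb0 !negbK => /eqP -> /eqP -> //.
move=> k kn phi; rewrite unit_sphereE unit_diskE => cphi phiS.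
have kC : (k.+1 < C)%N by rewrite Cn.
have phiP x : sphere x -> join_point (phi x).
  by move=> xS; apply/realization_joinP; apply: phiS; exists x.
have cphiv v : {within @sphere RR k, continuous (fun x => phi x v)}.
  apply/subspace_continuousP => x xS.
  move/subspace_continuousP/(_ x xS) : cphi => cphi.
  exact: (@cvg_comp _ _ RR phi (fun f : {ptws V -> RR} => f v) _ (nbhs (phi x)) _
    cphi (@ptws_eval_continuous RR _ v (phi x))).
have [psi [cpsi psiP psiE]] := @join_extension RR k A a0 C phi kC phiP cphiv.
exists psi; split.
- apply: continuous_in_subspaceT => x; rewrite inE => xD.
  by apply: (@cvg_ptws RR V _ (nbhs x)) => v; exact: cpsi.
- by move=> _ [x xD <-]; apply/realization_joinP; exact: psiP.
- by move=> x xS; apply/funext; exact: psiE.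
Qed.

End join_complex.

(** * The join of copies of G as a free complex *)

Section group_join.
Variables (gT : finGroupType) (C : nat).

Definition join_act (g : gT) (v : gT * 'I_C) : gT * 'I_C := ((g * v.1)%g, v.2).

Lemma join_act_gaction : is_gaction join_act.
Proof.
by split=> [[h i]|g h [l i]]; rewrite /join_act/= ?mul1g ?mulgA.
Qed.

Lemma join_is_EnG (n : nat) : C = n.+1 ->
  is_EnG n (join_complex gT C) join_act.
Proof.
move=> Cn; split.
- split; first split.
  + by apply/negP => /join_complexP[]; rewrite eqxx.
  + move=> s t /join_complexP[_ sP] /fintype.subsetP ts t0; apply/join_complexP.
    by split => // u v /ts us /ts vs; exact: sP.
  + exact: join_act_gaction.
  + move=> g s /join_complexP[s0 sP]; apply/join_complexP; split.
      by rewrite imset_eq0.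
    move=> _ _ /imsetP[u us ->] /imsetP[v vs ->] /= uv.
    by rewrite (sP u v us vs uv).
(* Colours are injective on a simplex, which bounds its size by [C]; the vertices [(1, i)] form a
   simplex attaining it. *)
- split=> [s /join_complexP[_ sP]|].
    by rewrite -(card_in_imset sP) (leq_trans (max_card _))// card_ord Cn.
  have inj1 : injective (fun i : 'I_C => (1%g : gT, i)) by move=> i j [].
  exists [set (1%g : gT, i) | i : 'I_C].
    apply/join_complexP; split.
      have C0 : (0 < C)%N by rewrite Cn.
      by apply/set0Pn; exists (1%g, Ordinal C0); apply: imset_f.
    by move=> _ _ /imsetP[i _ ->] /imsetP[j _ ->] /= ->.
  by rewrite card_imset// card_ord.
(* The action keeps colours, so a fixed [f] has [v] and its translate by [g^-1] in its support with
   one colour; they coincide and [g = 1]. *)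
- move=> g f /realization_joinP[_ f1 fP] gf.
  have [v fv] : exists v, f v != 0.
    apply: contrapT => f0; have : \sum_v f v = 0.
      rewrite big1// => v _; apply/eqP; apply: contraT => fv.
      by exfalso; apply: f0; exists v.
    by rewrite f1 => /eqP; rewrite oner_eq0.
  have fgv : f (join_act g^-1%g v) != 0.
    have <- : pt_act join_act g f v = f (join_act g^-1%g v) by [].
    by rewrite gf.
  have := fP _ _ fv fgv erefl; case: v {fv fgv} => h i [] /(congr1 (mulg g)).
  by rewrite mulKVg -[X in _ = X]mul1g => /mulIg.
- exact: join_connected 1%g n Cn.
Qed.

End group_join.

Lemma chromatic_number_colorable (T : finType) (e : rel T) : irreflexive e ->
  colorable e (chromatic_number e).
Proof.
move=> eirr; rewrite /chromatic_number; case: {-}_ / idP => [H|[]].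
  by case: ex_minnP.
(* Giving all vertices different colours excludes the junk branch of the definition. *)
apply/existsP; exists [ffun x => enum_rank x].
apply/forallP => x; apply/forallP => y; apply/implyP => xy.
by rewrite !ffunE (inj_eq enum_rank_inj); apply: contraTneq xy => ->; rewrite eirr.
Qed.

(** * Orbits of a free G-poset *)

Section Gposet.
Variables (gT : finGroupType) (T : finType) (le : rel T) (act : gT -> T -> T).
Hypothesis Gle : is_Gposet le act.
Hypothesis act_free : free_on act setT.

Let act1 x : act 1%g x = x.
Proof. by case: Gle => _ [] ->. Qed.

Let actM g h x : act (g * h)%g x = act g (act h x).
Proof. by case: Gle => _ [] _ ->. Qed.

Let actK g x : act g^-1%g (act g x) = x.
Proof. by rewrite -actM mulVg act1. Qed.

Let actKV g x : act g (act g^-1%g x) = x.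
Proof. by rewrite -actM mulgV act1. Qed.

Let act_le g x y : le x y -> le (act g x) (act g y).
Proof. by case: Gle => _ _; exact. Qed.

Let act_comparable g x y :
  comparableb le x y -> comparableb le (act g x) (act g y).
Proof. by case/orP => /(act_le g) xy; rewrite /comparableb xy ?orbT. Qed.

(** Translating x <= gx repeatedly gives gx <= g^m x for all m >= 1; at the order of [g] this reads
    gx <= x. *)
Lemma le_act_eq g x : le x (act g x) -> act g x = x.
Proof.
have [[lexx le_anti le_trans'] _ _] := Gle.
move=> xg; apply: le_anti; rewrite xg andbT.
have gxk m : le (act g x) (act (g ^+ m.+1)%g x).
  elim: m => [|m IHm]; first by rewrite expg1.
  by rewrite expgS actM; apply: act_le; apply: le_trans' xg IHm.
have := gxk #[g]%g.-1; rewrite prednK ?order_gt0//.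
by rewrite expg_order act1.
Qed.

(** The case gx <= x is [le_act_eq] for [g^-1] at [act g x]. *)
Lemma comparable_orbit x y : comparableb le x y -> Defs.in_orbit act x y -> x = y.
Proof.
move=> xy /existsP[g /eqP yE]; move: xy; rewrite yE => /orP[/le_act_eq//|gx].
by have := le_act_eq (g := g^-1%g) (x := act g x); rewrite actK => /(_ gx).
Qed.

Lemma in_orbit_act g x : Defs.in_orbit act (act g x) =1 Defs.in_orbit act x.
Proof.
move=> y; apply/existsP/existsP => -[h /eqP ->].
  by exists (h * g)%g; rewrite actM.
by exists (h * g^-1)%g; rewrite actM actK.
Qed.

(** [pick] sees only the orbit as a set, so the choice is constant along it. *)
Definition orbit_rep x : T := odflt x [pick y | Defs.in_orbit act x y].

Lemma orbit_repP x : Defs.in_orbit act x (orbit_rep x).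
Proof.
rewrite /orbit_rep; case: pickP => //= /(_ x); rewrite /Defs.in_orbit => /existsP[].
by exists 1%g; rewrite act1.
Qed.

Lemma orbit_rep_act g x : orbit_rep (act g x) = orbit_rep x.
Proof.
rewrite /orbit_rep (eq_pick (in_orbit_act g x)); case: pickP => //= /(_ x).
by move=> /existsP[]; exists 1%g; rewrite act1.
Qed.

Definition orbit_coord x : gT := odflt 1%g [pick g | x == act g (orbit_rep x)].

Lemma orbit_coordP x : act (orbit_coord x) (orbit_rep x) = x.
Proof.
rewrite /orbit_coord; case: pickP => [g /eqP <-//|/=].
have /existsP[g /eqP gx] := orbit_repP x.
by move=> /(_ g^-1%g); rewrite gx actK eqxx.
Qed.

(** Both sides carry the representative to [act g x]; freeness makes such a group element unique. *)
Lemma orbit_coord_act g x : orbit_coord (act g x) = (g * orbit_coord x)%g.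
Proof.
apply/eqP; rewrite eq_mulVg1; apply/eqP.
apply: (@act_free _ (orbit_rep x)) => //.
rewrite actM actM orbit_coordP.
have := orbit_coordP (act g x); rewrite orbit_rep_act.
by move=> /(congr1 (act (orbit_coord (act g x))^-1%g)); rewrite actK.
Qed.

(** * The equivariant map of a colouring *)

Section coloring.
Variables (C : nat) (c : T -> 'I_C).
Hypothesis c_proper : forall x y, strong_compat le act x y -> c x != c y.

Definition color_vertex x : gT * 'I_C := (orbit_coord x, c (orbit_rep x)).

Lemma color_vertex_act g x :
  color_vertex (act g x) = join_act g (color_vertex x).
Proof. by rewrite /color_vertex orbit_coord_act orbit_rep_act. Qed.

Lemma color_vertex_chain x y : comparableb le x y ->
  (color_vertex x).2 = (color_vertex y).2 -> color_vertex x = color_vertex y.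
Proof.
move=> xy /= cxy; have [/(comparable_orbit xy) -> //|xyN] := boolP (Defs.in_orbit act x y).
suff gg : orbit_coord x = orbit_coord y by rewrite /color_vertex gg cxy.
apply/eqP; apply: contraT => gN.
have /negP[] : c (orbit_rep x) != c (orbit_rep y); last by rewrite cxy.
apply: c_proper; apply/andP; split.
  (* Translating [x] and [y] by the inverse coordinate of [x] compares the representatives through a
     non-identity element. *)
  apply/existsP; exists ((orbit_coord x)^-1 * orbit_coord y)%g.
  rewrite -eq_mulVg1 gN actM orbit_coordP.
  rewrite -{1}(actK (orbit_coord x) (orbit_rep x)) orbit_coordP.
  exact: act_comparable.
apply: contra xyN => /existsP[h /eqP yx]; apply/existsP.
exists (orbit_coord y * h * (orbit_coord x)^-1)%g.
by rewrite -{2}(orbit_coordP x) !actM actK -yx orbit_coordP.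
Qed.

Lemma pushforward_Gmap :
  Gmap (pt_act act) (pt_act (@join_act gT C)) (realization (order_complex le))
    (realization (join_complex gT C)) (@pushforward RR _ _ color_vertex).
Proof.
split.
- by apply: continuous_subspaceT; exact: (@pushforward_continuous RR).
- move=> _ [f /realizationE[f0 f1 fS] <-]; apply/realization_joinP; split.
  + by move=> v; apply: sumr_ge0.
  + by rewrite -f1 [RHS](partition_big color_vertex xpredT).
  (* Nonzero coordinates of the image come from vertices of the chain supporting [f], which are
     pairwise comparable. *)
  + have pushP u : pushforward color_vertex f u != 0 ->
        exists2 x, color_vertex x = u & f x != 0.
      move=> fu; apply: contrapT => xN; case/eqP: fu; apply: big1 => x /eqP xu.
      by apply/eqP; apply: contraT => fx; exfalso; apply: xN; exists x.
    move=> u v /pushP[x <- fx] /pushP[y <- fy]; apply: color_vertex_chain.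
    move: fS; rewrite inE => /andP[_ /forall_inP/(_ x)].
    by rewrite inE => /(_ fx)/forall_inP/(_ y); rewrite inE; exact.
- move=> g f _; apply/funext => v; rewrite /pt_act /pushforward.
  rewrite (reindex (act g)); last first.
    by exists (act g^-1%g) => x _; [exact: actK|exact: actKV].
  apply: eq_big => [x|x _]; last by rewrite actK.
  have [j1 jM] := join_act_gaction gT C.
  rewrite color_vertex_act; apply/eqP/eqP => [<-|->].
    by rewrite -jM mulVg j1.
  by rewrite -jM mulgV j1.
Qed.

End coloring.
End Gposet.

(* ind_G ||Delta(P)|| + 1 <= chi(~C_P), where ind_G X = min { n | X -> E_nG } *)
Theorem theorem8 (gT : finGroupType) (T : finType) (le : rel T)
    (act : gT -> T -> T) :
  (1 < #|gT|)%N ->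
  (0 < #|T|)%N ->
  is_Gposet le act ->
  free_on act setT ->
  exists n : nat,
    (n + 1 <= chromatic_number (strong_compat le act))%N /\
    maps_to_EnG (pt_act act) (realization (order_complex le)) n.
Proof.
move=> _ /card_gt0P[x0 _] Gle act_free.
set e := strong_compat le act; set C := chromatic_number e.
have eirr : irreflexive e.
  move=> x; rewrite /e /strong_compat.
  suff -> : Defs.in_orbit act x x by rewrite andbF.
  by apply/existsP; exists 1%g; case: Gle => _ [-> _].
have /existsP[c /forallP cP] := chromatic_number_colorable eirr.
(* A point of the poset supplies a colour, so the dimension [C.-1] of the join satisfies
   [C.-1 + 1 = C]. *)
have C0 : (0 < C)%N by apply: leq_ltn_trans (ltn_ord (c x0)).
exists C.-1; split; first by rewrite addn1 prednK.
exists (gT * 'I_C)%type, (join_complex gT C), (@join_act gT C); split.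
  by apply: join_is_EnG; rewrite prednK.
exists (@pushforward RR _ _ (color_vertex act c)).
apply: pushforward_Gmap => // x y xy.
by move: (cP x) => /forallP/(_ y)/implyP; exact.
Qed.
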